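(* Let $t_0>0$, $\lambda\in\mathbb{C}$, and let $y:[t_0,\infty)\to\mathbb{C}$ solve $$\ddot y(t)+\frac{3}{t}\dot y(t)+\lambda y(t)=0$$ with initial data $(y(t_0),\dot y(t_0))\in\mathbb{C}^2$. As $t\to\infty$: (i) If $\lambda>0$, then $y(t)=O(t^{-3/2})\to0$ and $\dot y(t)=O(t^{-3/2})\to0$. (ii) If $\lambda<0$, write $\lambda=-\mu^2$ with $\mu>0$. There is a one-dimensional complex subspace $\mathcal{S}_\lambda\subset\mathbb{C}^2$ such that, for all initial data outside $\mathcal{S}_\lambda$, $|y(t)|\to\infty$ exponentially at rate $\mu$. For real initial data, the exceptional set $\mathcal{S}_\lambda\cap\mathbb{R}^2$ is a one-dimensional subspace of $\mathbb{R}^2$ and hence has Lebesgue measure zero. (iii) If $\lambda\in\mathbb{C}\setminus\mathbb{R}$, there is a one-dimensional complex subspace $\mathcal{S}_\lambda\subset\mathbb{C}^2$ such that, for all initial data outside $\mathcal{S}_\lambda$, $|y(t)|\to\infty$ exponentially at rate $|\mathrm{Im}(\sqrt\lambda)|$. Moreover, $\mathcal{S}_\lambda\cap\mathbb{R}^2=\{(0,0)\}$, so every nonzero real initial condition $(y(t_0),\dot y(t_0))\in\mathbb{R}^2$ yields exponential growth. (iv) If $\lambda=0$, then $$y(t)=y(t_0)+\frac{t_0}{2}\dot y(t_0)\left(1-\frac{t_0^2}{t^2}\right),\qquad \dot y(t)=\left(\frac{t_0}{t}\right)^3\dot y(t_0).$$ In particular, $y(t)$ converges to a finite limit and $\dot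 y(t)\to0$.
   Context: $\sqrt\lambda$ denotes the square root with $\Re(\sqrt\lambda)\ge0$. ''$|y(t)|\to\infty$ exponentially at rate $\rho$'' (with $\rho>0$) means $|y(t)|\to\infty$ and $\lim_{t\to\infty}\frac1t\log|y(t)|=\rho$. *)

(* Defs.v *)
(* Stdlib reals with Coquelicot.  MathComp-Analysis is loaded, but not imported,
   only for the Lebesgue measure: Stdlib's R is a realType there. *)
From Stdlib Require Import Reals Lra.
From mathcomp Require all_boot all_order all_algebra classical_sets.
From mathcomp Require measure lebesgue_measure lebesgue_integral.
From mathcomp Require reals Rstruct Rstruct_topology.
From Coquelicot Require Import Coquelicot.

Set Implicit Arguments.

Module LebesguePlane.
Import all_boot all_order all_algebra classical_sets reals.
Import measure lebesgue_measure lebesgue_integral Rstruct Rstruct_topology.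

Definition lebesgue2 :=
  product_measure1 (@lebesgue_measure (R : realType))
                   (@lebesgue_measure (R : realType)).

(* [negligible] asks for a measurable superset of measure zero, so that [A]
   itself need not be assumed measurable. *)
Definition null2 (A : R * R -> Prop) : Prop := negligible lebesgue2 A.
End LebesguePlane.

Definition lebesgue_null2 (A : R * R -> Prop) : Prop := LebesguePlane.null2 A.

Open Scope R_scope.

Definition C2 : ModuleSpace C_Ring :=
  prod_ModuleSpace C_Ring C_ModuleSpace C_ModuleSpace.
Definition R2 : ModuleSpace R_Ring :=
  prod_ModuleSpace R_Ring R_ModuleSpace R_ModuleSpace.

Definition is_subspace (K : Ring) (V : ModuleSpace K) (S : V -> Prop) : Prop :=
  S zero /\
  (forall u v : V, S u -> S v -> S (plus u v)) /\
  (forall (a : K) (u : V), S u -> S (scal a u)).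

Definition is_one_dim_subspace (K : Ring) (V : ModuleSpace K) (S : V -> Prop)
    : Prop :=
  is_subspace V S /\
  exists e : V, S e /\ e <> zero /\
    forall u : V, S u -> exists a : K, u = scal a e.

Definition real_points (S : C2 -> Prop) : R2 -> Prop :=
  fun p => S (RtoC (fst p), RtoC (snd p)).

(* [is_derive] with the neighbourhood filter restricted to [t0, +oo): the usual
   derivative for t > t0, the right derivative at t = t0. *)
Definition is_derive_from (t0 : R) (f : R -> C) (t : R) (l : C) : Prop :=
  @filterdiff R_AbsRing R_NormedModule C_R_NormedModule
    f (within (fun s : R => t0 <= s) (locally t)) (fun h : R => scal h l).

Definition solves (t0 : R) (lam : C) (y dy : R -> C) : Prop :=
  exists ddy : R -> C, forall t : R, t0 <= t ->
    is_derive_from t0 y t (dy t) /\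
    is_derive_from t0 dy t (ddy t) /\
    (ddy t + RtoC (3 / t) * dy t + lam * y t)%C = RtoC 0.

Definition tends_to (f : R -> C) (l : C) : Prop :=
  filterlim f (Rbar_locally p_infty) (locally l).

Definition is_O_infty (f : R -> C) (g : R -> R) : Prop :=
  exists M : R, Rbar_locally p_infty (fun t => Cmod (f t) <= M * Rabs (g t)).

Definition exp_growth (y : R -> C) (rho : R) : Prop :=
  0 < rho /\
  is_lim (fun t => Cmod (y t)) p_infty p_infty /\
  is_lim (fun t => / t * ln (Cmod (y t))) p_infty rho.

(* The square root with nonnegative real part, see [Csqrt_sqr], [Csqrt_re_ge0]
   and [Csqrt_unique]; on the negative reals, where both roots have real part 0,
   the one with positive imaginary part is taken. *)
Definition Csqrt (z : C) : C :=
  (sqrt ((Cmod z + Re z) / 2),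
   (if Rlt_dec (Im z) 0 then -1 else 1) * sqrt ((Cmod z - Re z) / 2)).

Lemma Csqrt_re_ge0 (z : C) : 0 <= Re (Csqrt z).
Proof. exact (sqrt_pos _). Qed.

Lemma Csqrt_sqr (z : C) : (Csqrt z * Csqrt z)%C = z.
Proof.
destruct z as [a b].
assert (H2 : Cmod (a, b) * Cmod (a, b) = a * a + b * b).
{ unfold Cmod; rewrite sqrt_sqrt; cbn [fst snd]; nra. }
pose proof (Cmod_ge_0 (a, b)) as H0.
unfold Csqrt; set (r := Cmod (a, b)) in *; cbn [Re Im fst snd].
assert (Hp : 0 <= (r + a) / 2) by nra.
assert (Hm : 0 <= (r - a) / 2) by nra.
assert (Hpm : sqrt ((r + a) / 2) * sqrt ((r - a) / 2) = Rabs b / 2).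
{ rewrite <- sqrt_mult by assumption.
  replace ((r + a) / 2 * ((r - a) / 2)) with (Rsqr (Rabs b / 2)).
  - apply sqrt_Rsqr; pose proof (Rabs_pos b); lra.
  - unfold Rsqr.
    replace (Rabs b / 2 * (Rabs b / 2)) with (Rabs b * Rabs b / 4) by field.
    rewrite <- Rabs_mult, Rabs_pos_eq by nra. nra. }
pose proof (sqrt_sqrt _ Hp) as Ep; pose proof (sqrt_sqrt _ Hm) as Em.
unfold Cmult; cbn [fst snd].
destruct (Rlt_dec b 0) as [Hb | Hb];
  [rewrite Rabs_left in Hpm by lra | rewrite Rabs_pos_eq in Hpm by lra];
  f_equal; nra.
Qed.

Lemma Csqrt_unique (z w : C) :
  Im z <> 0 -> (w * w)%C = z -> 0 <= Re w -> w = Csqrt z.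
Proof.
intros Hz Hw Hre.
assert (E : ((w - Csqrt z) * (w + Csqrt z))%C = RtoC 0).
{ transitivity (w * w - Csqrt z * Csqrt z)%C; [ring |].
  rewrite Hw, Csqrt_sqr; ring. }
destruct (Ceq_dec (w + Csqrt z) 0) as [Hs | Hs].
- exfalso; apply Hz; pose proof (Csqrt_re_ge0 z) as Hs0.
  apply (f_equal Re) in Hs; cbn in Hs; cbn in Hs0.
  destruct w as [u v]; cbn in Hs, Hre.
  assert (u = 0) by lra; subst u z; cbn; ring.
- destruct (Ceq_dec (w - Csqrt z) 0) as [Hd | Hd].
  + replace w with ((w - Csqrt z) + Csqrt z)%C by ring. rewrite Hd; ring.
  + exfalso; exact (Cmult_neq_0 _ _ Hd Hs E).
Qed.

(* Main.v *)
(* If w^2 = -lam with kappa = Re w > 0, the modes p = y' + w y and m = y' - w y obey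
   p' = w p - (3/t) y' and m' = - w m - (3/t) y', with y' = (p + m) / 2.  Once t is
   large, |p|^2 / 4 - |m|^2 is nondecreasing.  If it is ever positive, then |m| < |p| / 2
   from there on, |p|^2 e^(-2 kappa t) is nonincreasing and t^6 |p|^2 e^(-2 kappa t)
   nondecreasing, which gives the rate kappa.  Otherwise p is controlled by m, and the
   solution decays.

   Two decaying solutions have proportional initial data, because t^3 times their
   Wronskian is constant and tends to 0.  The real quantity t^3 Im (y' conj y) has
   derivative - Im lam t^3 |y|^2 and tends to 0 along a decaying solution; hence the
   decaying data lie on a real line if lam is real, and no nonzero real data decay if
   lam is not real.  Existence of solutions is never needed: the exceptional subspace is
   the line through the data of a nonzero decaying solution if there is one, and an
   arbitrary suitable line otherwise.

   For lam > 0 the energy of t^(3/2) y stays bounded; for lam = 0, t^3 y' and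
   y + t y' / 2 are constant. *)
Require Import Defs.
From Stdlib Require Import Reals Lra Classical.
From mathcomp Require all_boot all_order all_algebra mathcomp_extra.
From mathcomp Require classical_sets functions.
From mathcomp Require measure lebesgue_measure lebesgue_integral measurable_realfun.
From mathcomp Require reals Rstruct Rstruct_topology.
From Coquelicot Require Import Coquelicot.
Set Implicit Arguments.
Open Scope R_scope.

(** * Lines are Lebesgue null *)

Module NullLine.
Import all_boot all_order all_algebra mathcomp_extra classical_sets functions reals.
Local Open Scope classical_set_scope.
Import measure lebesgue_measure lebesgue_integral measurable_realfun Rstruct Rstruct_topology.
Import GRing.Theory.

(** Each vertical section of the graph is a singleton, so the integral of the section measures,
    which is the product measure, vanishes. *)
Lemma null2_graph (k : R) : LebesguePlane.null2 (fun p => snd p = Rmult k (fst p)).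
Proof.
pose A : set (R * R) := fun p => snd p = Rmult k (fst p).
exists A; split=> //.
- have -> : A = (fun p : R * R => (p.2 - k * p.1)%R) @^-1` [set 0%R].
    apply/seteqP; split=> -[x y] /=; rewrite /A /=.
    + by move=> ->; rewrite RmultE subrr.
    + by move/eqP; rewrite subr_eq0 => /eqP ->.
  rewrite -[X in measurable X]setTI.
  have mf : measurable_fun setT
      (fun p : measurableTypeR R * measurableTypeR R => (p.2 - k * p.1)%R).
    apply: measurable_funB; first exact: measurable_snd.
    apply: measurable_funM; [exact: measurable_cst|exact: measurable_fst].
  by apply: mf => //; exact: measurable_set1.
- rewrite /LebesguePlane.lebesgue2 /product_measure1 /=.
  apply: integral0_eq => x _ /=.
  have -> : xsection A x = [set Rmult k x].
    by apply/seteqP; split=> y; rewrite /xsection /= ?inE /A.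
  exact: lebesgue_measure_set1.
Qed.

(** The vertical line is not a graph over the first coordinate. It is the rectangle [{0} x R], of
    measure [0 * oo = 0]. *)
Lemma null2_axis : LebesguePlane.null2 (fun p => fst p = R0).
Proof.
exists ([set R0] `*` setT); split.
- by apply: measurableX => //; apply: measurable_set1.
- rewrite /LebesguePlane.lebesgue2 product_measure1E//.
  by rewrite [X in constructive_ereal.mule X _]lebesgue_measure_set1 constructive_ereal.mul0e.
- by move=> p /= ->.
Qed.

Lemma null2_subset (A B : R * R -> Prop) :
  LebesguePlane.null2 B -> (forall p, A p -> B p) -> LebesguePlane.null2 A.
Proof. by move=> [X [mX X0 BX]] AB; exists X; split=> // p /AB /BX. Qed.
End NullLine.


(** * Monotone functions on a half-line *)

Lemma nondecreasing_from (t0 : R) (f df : R -> R) :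
  (forall t, t0 <= t -> is_derive f t (df t)) ->
  (forall t, t0 <= t -> 0 <= df t) ->
  forall s t, t0 <= s -> s <= t -> f s <= f t.
Proof.
intros Hd Hp s t Hs Hst.
destruct (MVT_gen f s t df) as [c [Hc E]];
  rewrite ?Rmin_left, ?Rmax_right in * by lra.
- intros x Hx; apply Hd; lra.
- intros x Hx; apply derivable_continuous_pt.
  exists (df x); apply is_derive_Reals, Hd; lra.
- assert (0 <= df c) by (apply Hp; lra). nra.
Qed.

Lemma nonincreasing_from (t0 : R) (f df : R -> R) :
  (forall t, t0 <= t -> is_derive f t (df t)) ->
  (forall t, t0 <= t -> df t <= 0) ->
  forall s t, t0 <= s -> s <= t -> f t <= f s.
Proof.
intros Hd Hp s t Hs Hst.
enough (- f s <= - f t) by lra.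
apply (@nondecreasing_from t0 (fun x => - f x) (fun x => - df x)); auto.
- intros x Hx; apply (is_derive_opp f), Hd, Hx.
- intros x Hx; specialize (Hp x Hx); lra.
Qed.

Lemma constant_from (t0 : R) (f : R -> R) :
  (forall t, t0 <= t -> is_derive f t 0) -> forall t, t0 <= t -> f t = f t0.
Proof.
intros Hd t Ht; apply Rle_antisym.
- apply (@nonincreasing_from t0 f (fun _ => 0)); auto; intros; lra.
- apply (@nondecreasing_from t0 f (fun _ => 0)); auto; intros; lra.
Qed.

(** A negative value [f s] bounds all later values from above, so [t * |f t|] would grow at least
    linearly. *)
Lemma nonincreasing_vanishing_ge0 (t0 T K : R) (f : R -> R) :
  (forall s t, t0 <= s -> s <= t -> f t <= f s) ->
  (forall t, T <= t -> t * Rabs (f t) <= K) ->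
  forall s, t0 <= s -> 0 <= f s.
Proof.
intros Hm Hv s Hs; apply Rnot_lt_le; intros Hneg.
(* At this time [t * (- f s) >= K + 1], against the bound [K]. *)
set (t := Rmax s (Rmax T (Rmax 1 ((K + 1) / - f s)))).
assert (s <= t) by apply Rmax_l.
assert (Rmax T (Rmax 1 ((K + 1) / - f s)) <= t) by apply Rmax_r.
assert (T <= t) by (eapply Rle_trans; [apply Rmax_l | eassumption]).
assert (Ht1 : Rmax 1 ((K + 1) / - f s) <= t)
  by (eapply Rle_trans; [apply Rmax_r | eassumption]).
assert (1 <= t) by (eapply Rle_trans; [apply Rmax_l | eassumption]).
assert (Ht2 : (K + 1) / - f s <= t)
  by (eapply Rle_trans; [apply Rmax_r | eassumption]).
specialize (Hv t ltac:(assumption)); specialize (Hm s t Hs ltac:(assumption)).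
rewrite Rabs_left in Hv by lra.
apply (Rmult_le_compat_r (- f s)) in Ht2; [| lra].
replace ((K + 1) / - f s * - f s) with (K + 1) in Ht2 by (field; lra).
nra.
Qed.

(** * Growing and decaying modes *)

(* [y = y1 + i y2], [dy = z1 + i z2] and [lam = a + i b]. *)
Definition real_system (t0 a b : R) (y1 y2 z1 z2 : R -> R) : Prop :=
  forall t, t0 <= t ->
    is_derive y1 t (z1 t) /\ is_derive y2 t (z2 t) /\
    is_derive z1 t (- (3 / t * z1 t) - (a * y1 t - b * y2 t)) /\
    is_derive z2 t (- (3 / t * z2 t) - (a * y2 t + b * y1 t)).

(* [auto_derive] leaves the derivative of an unknown [f] in eta-expanded form. *)
Ltac rewrite_derive h :=
  match type of h with
  | is_derive ?f ?x ?l =>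
      try replace (Derive (fun u : R => f u) x) with l
        by (symmetry; exact (is_derive_unique f x l h))
  end.

Ltac derive_system H t Ht :=
  let h1 := fresh in let h2 := fresh in let h3 := fresh in let h4 := fresh in
  destruct (H t Ht) as [h1 [h2 [h3 h4]]];
  auto_derive;
  [ repeat split; try (eexists; eassumption); try lra; auto
  | rewrite_derive h1; rewrite_derive h2; rewrite_derive h3; rewrite_derive h4 ].

(* Any decay of [|y| ^ 2 + |dy| ^ 2] faster than [t ^ -3] would do. *)
Definition decaying (y1 y2 z1 z2 : R -> R) : Prop :=
  exists T K : R, forall t, T <= t ->
    t ^ 4 * (y1 t ^ 2 + y2 t ^ 2 + z1 t ^ 2 + z2 t ^ 2) <= K.

Section Dichotomy.
Variables (t0 a b kappa nu : R) (y1 y2 z1 z2 : R -> R).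
Hypothesis t0_gt0 : 0 < t0.
Hypothesis kappa_gt0 : 0 < kappa.
Hypothesis square_re : kappa ^ 2 - nu ^ 2 = - a.
Hypothesis square_im : 2 * kappa * nu = - b.
Hypothesis sys : real_system t0 a b y1 y2 z1 z2.

(* With [w = kappa + i nu], so that [w ^ 2 = - lam]: [p = dy + w y] and [m = dy - w y]. *)
Let p1 t := z1 t + (kappa * y1 t - nu * y2 t).
Let p2 t := z2 t + (kappa * y2 t + nu * y1 t).
Let m1 t := z1 t - (kappa * y1 t - nu * y2 t).
Let m2 t := z2 t - (kappa * y2 t + nu * y1 t).
Let P t := p1 t ^ 2 + p2 t ^ 2.
Let M t := m1 t ^ 2 + m2 t ^ 2.
(** The real part of [p conj m]. Since [dy = (p + m) / 2], twice the real part of [dy conj p] is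
    [P + pm], and twice that of [dy conj m] is [M + pm]. *)
Let pm t := p1 t * m1 t + p2 t * m2 t.
(** Beyond [T0] the damping coefficient satisfies [3 / t <= 2 kappa / 5], small enough to be
    absorbed by the exponential rates. *)
Let T0 := Rmax t0 (15 / (2 * kappa)).

Lemma growing_mode_derive t :
  t0 <= t -> is_derive P t (2 * kappa * P t - 3 / t * (P t + pm t)).
Proof.
intros Ht; unfold P, M, pm, p1, p2, m1, m2.
derive_system sys t Ht.
replace a with (nu ^ 2 - kappa ^ 2) by lra.
replace b with (- (2 * kappa * nu)) by lra.
field; lra.
Qed.

Lemma decaying_mode_derive t :
  t0 <= t -> is_derive M t (- 2 * kappa * M t - 3 / t * (M t + pm t)).
Proof.
intros Ht; unfold P, M, pm, p1, p2, m1, m2.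
derive_system sys t Ht.
replace a with (nu ^ 2 - kappa ^ 2) by lra.
replace b with (- (2 * kappa * nu)) by lra.
field; lra.
Qed.

Lemma mode_product_bound t : Rabs (pm t) <= (P t + M t) / 2.
Proof.
unfold P, M, pm; apply Rabs_le; split.
- pose proof (pow2_ge_0 (p1 t + m1 t)); pose proof (pow2_ge_0 (p2 t + m2 t)); lra.
- pose proof (pow2_ge_0 (p1 t - m1 t)); pose proof (pow2_ge_0 (p2 t - m2 t)); lra.
Qed.

Lemma damping_bound t : T0 <= t -> t0 <= t /\ 0 < / t /\ / t * 15 <= 2 * kappa.
Proof.
intros Ht.
assert (t0 <= t) by (eapply Rle_trans; [apply Rmax_l | exact Ht]).
assert (Ht' : 15 / (2 * kappa) <= t) by (eapply Rle_trans; [apply Rmax_r | exact Ht]).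
split; [assumption | split; [apply Rinv_0_lt_compat; lra |]].
apply (Rmult_le_compat_r (2 * kappa)) in Ht'; [| lra].
replace (15 / (2 * kappa) * (2 * kappa)) with 15 in Ht' by (field; lra).
apply (Rmult_le_reg_l t); [lra |].
replace (t * (/ t * 15)) with 15 by (field; lra). lra.
Qed.

Lemma mode_nonneg t : 0 <= P t /\ 0 <= M t.
Proof.
unfold P, M; split; apply Rplus_le_le_0_compat; apply pow2_ge_0.
Qed.

(** With [Q = P / 4 + M] the derivative is [2 kappa Q - (3 / t) (P / 4 - M - 3 pm / 4)]. The last
    bracket is at most [5 Q / 2] and [3 / t <= 2 kappa / 5], so at least [kappa Q] remains. *)
Lemma mode_gap_nondecreasing s t :
  T0 <= s -> s <= t -> P s / 4 - M s <= P t / 4 - M t.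
Proof.
apply (@nondecreasing_from T0 (fun t => P t / 4 - M t)
  (fun t => (2 * kappa * P t - 3 / t * (P t + pm t)) / 4
            - (- 2 * kappa * M t - 3 / t * (M t + pm t)))).
- intros x Hx; destruct (damping_bound Hx) as [H0 _].
  pose proof (growing_mode_derive H0) as HP.
  pose proof (decaying_mode_derive H0) as HM.
  auto_derive; [split; [eexists; exact HP | split; [eexists; exact HM | auto]] |].
  rewrite_derive HP; rewrite_derive HM; field; lra.
- intros x Hx; destruct (damping_bound Hx) as [H0 [H1 H2]].
  destruct (mode_nonneg x) as [HP HM].
  pose proof (mode_product_bound x) as Hpm; apply Rabs_le_between in Hpm.
  unfold Rdiv; set (i := / x) in *.
  assert (Hi : 3 * i <= 2 * kappa / 5) by lra.
  set (Q := P x / 4 + M x).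
  assert (HQ : 3 * i * (P x * / 4 - M x - 3 / 4 * pm x) <= 2 * kappa / 5 * (5 / 2 * Q)).
  { apply Rle_trans with (3 * i * (5 / 2 * Q)).
    - apply Rmult_le_compat_l; unfold Q; lra.
    - apply Rmult_le_compat_r; unfold Q; lra. }
  assert (0 <= kappa * Q) by (unfold Q; apply Rmult_le_pos; lra).
  unfold Q in *; lra.
Qed.

(** These are the squared norms of [dy = (p + m) / 2] and [w y = (p - m) / 2]. *)
Lemma modes_energy t :
  z1 t ^ 2 + z2 t ^ 2 = (P t + M t + 2 * pm t) / 4 /\
  (kappa ^ 2 + nu ^ 2) * (y1 t ^ 2 + y2 t ^ 2) = (P t + M t - 2 * pm t) / 4.
Proof. unfold P, M, pm, p1, p2, m1, m2; split; field. Qed.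

(** Here [P <= 4 M], hence [- (M + pm) <= 3 M / 2]. The derivative of [t ^ 4 M] is then at most
    [t ^ 4 M (17 / (2 t) - 2 kappa)], which is nonpositive beyond [T0]. *)
Lemma decaying_of_gap_nonpos :
  (forall t, T0 <= t -> P t / 4 - M t <= 0) -> decaying y1 y2 z1 z2.
Proof.
intros Hgap.
assert (Hdec : forall t, T0 <= t -> t ^ 4 * M t <= T0 ^ 4 * M T0).
{ intros t Ht.
  apply (@nonincreasing_from T0 (fun t => t ^ 4 * M t)
    (fun t => 4 * t ^ 3 * M t
              + t ^ 4 * (- 2 * kappa * M t - 3 / t * (M t + pm t)))); try lra.
  - intros x Hx; destruct (damping_bound Hx) as [H0 _].
    pose proof (decaying_mode_derive H0) as HM.
    auto_derive; [repeat split; eexists; eassumption |].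
    rewrite_derive HM; ring.
  - intros x Hx; destruct (damping_bound Hx) as [H0 [H1 H2]].
    destruct (mode_nonneg x) as [HP HM].
    pose proof (mode_product_bound x) as Hpm; apply Rabs_le_between in Hpm.
    specialize (Hgap x Hx).
    replace (4 * x ^ 3 * M x + x ^ 4 * (- 2 * kappa * M x - 3 / x * (M x + pm x)))
      with (x ^ 4 * (/ x * 4 * M x - 2 * kappa * M x - 3 * / x * (M x + pm x)))
      by (field; lra).
    assert (0 < x ^ 4) by (apply pow_lt; lra).
    assert (3 * / x * - (M x + pm x) <= 3 * / x * (3 / 2 * M x))
      by (apply Rmult_le_compat_l; lra).
    assert (/ x * 15 * M x <= 2 * kappa * M x) by (apply Rmult_le_compat_r; lra).
    assert (0 <= / x * M x) by (apply Rmult_le_pos; lra).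
    nra. }
set (w := kappa ^ 2 + nu ^ 2).
assert (Hw : 0 < w) by (unfold w; pose proof (pow2_ge_0 nu); nra).
(* Since [2 pm <= P + M <= 5 M] and likewise for [- 2 pm], both [|dy| ^ 2] and [|w y| ^ 2] are at
   most [5 M / 2]. *)
exists T0, ((5 / 2 + 5 / 2 / w) * (T0 ^ 4 * M T0)).
intros t Ht.
destruct (modes_energy t) as [Ez Ey]; fold w in Ey.
destruct (mode_nonneg t) as [HP HM].
pose proof (mode_product_bound t) as Hpm; apply Rabs_le_between in Hpm.
specialize (Hgap t Ht); specialize (Hdec t Ht).
assert (Hy : y1 t ^ 2 + y2 t ^ 2 <= 5 / 2 / w * M t).
{ apply (Rmult_le_reg_l w); [exact Hw |]; rewrite Ey.
  replace (w * (5 / 2 / w * M t)) with (5 / 2 * M t) by (field; lra). lra. }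
assert (0 <= t ^ 4) by (replace (t ^ 4) with ((t ^ 2) ^ 2) by ring; apply pow2_ge_0).
assert (0 < 5 / 2 / w) by (apply Rdiv_lt_0_compat; lra).
apply Rle_trans with (t ^ 4 * ((5 / 2 + 5 / 2 / w) * M t)).
- apply Rmult_le_compat_l; lra.
- replace (t ^ 4 * ((5 / 2 + 5 / 2 / w) * M t))
    with ((5 / 2 + 5 / 2 / w) * (t ^ 4 * M t)) by ring.
  apply Rmult_le_compat_l; lra.
Qed.

Lemma growth_of_gap_pos t1 :
  T0 <= t1 -> 0 < P t1 / 4 - M t1 ->
  exists k1 k2 T : R, 0 < k1 /\ 0 < T /\ forall t, T <= t ->
    k1 * exp (2 * kappa * t) / t ^ 6 <= y1 t ^ 2 + y2 t ^ 2
      <= k2 * exp (2 * kappa * t).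
Proof.
intros Ht1 Hgap1.
assert (Hgap : forall t, t1 <= t -> 0 < P t / 4 - M t).
{ intros t Ht; eapply Rlt_le_trans; [exact Hgap1 |].
  apply mode_gap_nondecreasing; assumption. }
assert (HPd : forall t, t1 <= t -> is_derive P t (2 * kappa * P t - 3 / t * (P t + pm t))).
{ intros t Ht; apply growing_mode_derive.
  destruct (@damping_bound t); lra. }
(* Once [M < P / 4], [|pm| <= (P + M) / 2 < P]. *)
assert (Hrange : forall t, t1 <= t -> 0 < / t /\ 0 <= P t + pm t <= 2 * P t).
{ intros t Ht; destruct (@damping_bound t) as [_ [H0 _]]; [lra |].
  destruct (mode_nonneg t) as [HP HM].
  pose proof (mode_product_bound t) as Hpm; apply Rabs_le_between in Hpm.
  specialize (Hgap t Ht); lra. }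
assert (Ht1pos : 0 < t1) by (destruct (@damping_bound t1); lra).
(* By [P + pm <= 2 P] the damping lowers the rate of [P] by at most [6 / t], which the factor
   [t ^ 6] compensates. *)
assert (Hlow : forall t, t1 <= t ->
  P t1 * exp (- 2 * kappa * t1) * t1 ^ 6 <= P t * exp (- 2 * kappa * t) * t ^ 6).
{ intros t Ht.
  apply (@nondecreasing_from t1 (fun t => P t * exp (- 2 * kappa * t) * t ^ 6)
    (fun t => exp (- 2 * kappa * t) * t ^ 6 * (3 * / t * (2 * P t - (P t + pm t)))));
    try lra.
  - intros x Hx; specialize (HPd x Hx).
    auto_derive; [repeat split; eexists; eassumption |].
    rewrite_derive HPd; field; lra.
  - intros x Hx; destruct (Hrange x Hx).
    repeat apply Rmult_le_pos; try lra; left; apply exp_pos. }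
assert (Hup : forall t, t1 <= t ->
  P t * exp (- 2 * kappa * t) <= P t1 * exp (- 2 * kappa * t1)).
{ intros t Ht.
  apply (@nonincreasing_from t1 (fun t => P t * exp (- 2 * kappa * t))
    (fun t => - (exp (- 2 * kappa * t) * (3 * / t * (P t + pm t)))));
    try lra.
  - intros x Hx; specialize (HPd x Hx).
    auto_derive; [repeat split; eexists; eassumption |].
    rewrite_derive HPd; field; lra.
  - intros x Hx; destruct (Hrange x Hx).
    apply Rge_le, Ropp_0_le_ge_contravar.
    repeat apply Rmult_le_pos; try lra; left; apply exp_pos. }
set (w := kappa ^ 2 + nu ^ 2).
assert (Hw : 0 < w) by (unfold w; pose proof (pow2_ge_0 nu); nra).
set (c := P t1 * exp (- 2 * kappa * t1)) in *.
assert (HP1 : 0 < P t1) by (destruct (mode_nonneg t1); lra).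
(* The constants come from [P / 16 <= |w y| ^ 2 <= P]. *)
exists (c * t1 ^ 6 / (16 * w)), (c / w), t1.
assert (Hc : 0 < c) by (apply Rmult_lt_0_compat; [exact HP1 | apply exp_pos]).
split; [| split; [assumption |]].
{ apply Rdiv_lt_0_compat; [apply Rmult_lt_0_compat; [exact Hc | apply pow_lt, Ht1pos] | lra]. }
intros t Ht.
destruct (modes_energy t) as [_ Ey]; fold w in Ey.
(* From [|p - 2 m| ^ 2 >= 0]. This weighting gives [P + M - 2 pm >= P / 2 - M > P / 4], whereas the
   symmetric bound on [pm] would only give [0]. *)
assert (Hpm1 : 2 * pm t <= P t / 2 + 2 * M t).
{ unfold pm, P, M. pose proof (pow2_ge_0 (p1 t - 2 * m1 t));
  pose proof (pow2_ge_0 (p2 t - 2 * m2 t)). lra. }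
pose proof (mode_product_bound t) as Hpm; apply Rabs_le_between in Hpm.
specialize (Hgap t Ht); specialize (Hlow t Ht); specialize (Hup t Ht).
destruct (mode_nonneg t) as [HP HM].
assert (Hexp : exp (- 2 * kappa * t) * exp (2 * kappa * t) = 1).
{ rewrite <- exp_plus, <- exp_0; f_equal; ring. }
pose proof (exp_pos (2 * kappa * t)) as He.
set (e := exp (2 * kappa * t)) in *; set (e' := exp (- 2 * kappa * t)) in *.
assert (Ht6 : 0 < t ^ 6) by (apply pow_lt; lra).
assert (HPlow : c * t1 ^ 6 * e / t ^ 6 <= P t).
{ apply (Rmult_le_reg_r (t ^ 6)); [exact Ht6 |].
  replace (c * t1 ^ 6 * e / t ^ 6 * t ^ 6) with (c * t1 ^ 6 * e) by (field; lra).
  replace (P t * t ^ 6) with (P t * e' * t ^ 6 * e)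
    by (transitivity (P t * t ^ 6 * (e' * e)); [ring | rewrite Hexp; ring]).
  apply Rmult_le_compat_r; lra. }
assert (HPup : P t <= c * e).
{ replace (P t) with (P t * e' * e)
    by (transitivity (P t * (e' * e)); [ring | rewrite Hexp; ring]).
  apply Rmult_le_compat_r; lra. }
split; apply (Rmult_le_reg_l w); try exact Hw; rewrite Ey.
- replace (w * (c * t1 ^ 6 / (16 * w) * e / t ^ 6)) with (c * t1 ^ 6 * e / t ^ 6 / 16)
    by (field; lra).
  lra.
- replace (w * (c / w * e)) with (c * e) by (field; lra). lra.
Qed.

Lemma dichotomy :
  decaying y1 y2 z1 z2 \/
  exists k1 k2 T : R, 0 < k1 /\ 0 < T /\ forall t, T <= t ->
    k1 * exp (2 * kappa * t) / t ^ 6 <= y1 t ^ 2 + y2 t ^ 2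
      <= k2 * exp (2 * kappa * t).
Proof.
destruct (classic (exists t1, T0 <= t1 /\ 0 < P t1 / 4 - M t1)) as [[t1 [H1 H2]] | Hno].
- right; exact (growth_of_gap_pos H1 H2).
- left; apply decaying_of_gap_nonpos; intros t Ht.
  apply Rnot_lt_le; intros Hlt; apply Hno; exists t; split; assumption.
Qed.
End Dichotomy.

(** * Initial data of decaying solutions *)

(** The decay [t ^ -4] of the squared norms beats the weight [t ^ 3] by one power. This serves both
    the Wronskian and the flux, which are quadratic in the data. *)
Lemma cubic_product_vanishes (y1 y2 z1 z2 v1 v2 w1 w2 : R -> R) (f : R -> R) :
  decaying y1 y2 z1 z2 -> decaying v1 v2 w1 w2 ->
  (forall t, Rabs (f t) <= y1 t ^ 2 + y2 t ^ 2 + z1 t ^ 2 + z2 t ^ 2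
                           + (v1 t ^ 2 + v2 t ^ 2 + w1 t ^ 2 + w2 t ^ 2)) ->
  exists T K : R, forall t, T <= t -> t * Rabs (t ^ 3 * f t) <= K.
Proof.
intros [T [K H]] [T' [K' H']] Hf.
exists (Rmax 0 (Rmax T T')), (K + K'); intros t Ht.
assert (Ht0 : 0 <= t) by (eapply Rle_trans; [apply Rmax_l | exact Ht]).
assert (Hm : Rmax T T' <= t) by (eapply Rle_trans; [apply Rmax_r | exact Ht]).
specialize (H t (Rle_trans _ _ _ (Rmax_l _ _) Hm)).
specialize (H' t (Rle_trans _ _ _ (Rmax_r _ _) Hm)).
rewrite Rabs_mult, (Rabs_pos_eq (t ^ 3)) by (apply pow_le, Ht0).
replace (t * (t ^ 3 * Rabs (f t))) with (t ^ 4 * Rabs (f t)) by ring.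
specialize (Hf t); apply (Rmult_le_compat_l (t ^ 4)) in Hf; [| apply pow_le, Ht0].
lra.
Qed.

Section Subdominant.
Variables (t0 a b : R).
Hypothesis t0_gt0 : 0 < t0.

Lemma constant_vanishing (f : R -> R) (T K : R) :
  (forall t, t0 <= t -> is_derive f t 0) ->
  (forall t, T <= t -> t * Rabs (f t) <= K) -> f t0 = 0.
Proof.
intros Hd Hv.
assert (Hc : forall t, t0 <= t -> f t = f t0) by (apply constant_from, Hd).
apply Rle_antisym.
- enough (0 <= - f t0) by lra.
  apply (@nonincreasing_vanishing_ge0 t0 T K (fun t => - f t)); try lra.
  + intros s t Hs Hst; rewrite (Hc s), (Hc t) by lra; lra.
  + intros t Ht; rewrite Rabs_Ropp; auto.
- apply (@nonincreasing_vanishing_ge0 t0 T K f); try lra; auto.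
  intros s t Hs Hst; rewrite (Hc s), (Hc t) by lra; lra.
Qed.

(** The two equations are the real and imaginary parts of the Wronskian [W = y w - z v]. Abel's
    identity [W' = - (3 / t) W] makes [t ^ 3 W] constant, and decay makes this constant zero. *)
Lemma decaying_wronskian (y1 y2 z1 z2 v1 v2 w1 w2 : R -> R) :
  real_system t0 a b y1 y2 z1 z2 -> real_system t0 a b v1 v2 w1 w2 ->
  decaying y1 y2 z1 z2 -> decaying v1 v2 w1 w2 ->
  (y1 t0 * w1 t0 - y2 t0 * w2 t0) - (z1 t0 * v1 t0 - z2 t0 * v2 t0) = 0 /\
  (y1 t0 * w2 t0 + y2 t0 * w1 t0) - (z1 t0 * v2 t0 + z2 t0 * v1 t0) = 0.
Proof.
intros Hy Hv Dy Dv.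
set (W1 t := (y1 t * w1 t - y2 t * w2 t) - (z1 t * v1 t - z2 t * v2 t)).
set (W2 t := (y1 t * w2 t + y2 t * w1 t) - (z1 t * v2 t + z2 t * v1 t)).
assert (H3 : t0 ^ 3 <> 0) by (apply pow_nonzero; lra).
split; apply (Rmult_eq_reg_l (t0 ^ 3)); try exact H3; rewrite Rmult_0_r.
- destruct (@cubic_product_vanishes _ _ _ _ _ _ _ _ W1 Dy Dv) as [T [K HK]].
  { intros t; unfold W1; apply Rabs_le; split.
    - pose proof (pow2_ge_0 (y1 t + w1 t)); pose proof (pow2_ge_0 (y2 t - w2 t));
      pose proof (pow2_ge_0 (z1 t - v1 t)); pose proof (pow2_ge_0 (z2 t + v2 t)); nra.
    - pose proof (pow2_ge_0 (y1 t - w1 t)); pose proof (pow2_ge_0 (y2 t + w2 t));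
      pose proof (pow2_ge_0 (z1 t + v1 t)); pose proof (pow2_ge_0 (z2 t - v2 t)); nra. }
  apply (@constant_vanishing (fun t => t ^ 3 * W1 t) T K); [| exact HK].
  intros t Ht; destruct (Hv t Ht) as [V1 [V2 [V3 V4]]]; unfold W1.
  derive_system Hy t Ht.
  rewrite_derive V1; rewrite_derive V2; rewrite_derive V3; rewrite_derive V4.
  field; lra.
- destruct (@cubic_product_vanishes _ _ _ _ _ _ _ _ W2 Dy Dv) as [T [K HK]].
  { intros t; unfold W2; apply Rabs_le; split.
    - pose proof (pow2_ge_0 (y1 t + w2 t)); pose proof (pow2_ge_0 (y2 t + w1 t));
      pose proof (pow2_ge_0 (z1 t - v2 t)); pose proof (pow2_ge_0 (z2 t - v1 t)); nra.
    - pose proof (pow2_ge_0 (y1 t - w2 t)); pose proof (pow2_ge_0 (y2 t - w1 t));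
      pose proof (pow2_ge_0 (z1 t + v2 t)); pose proof (pow2_ge_0 (z2 t + v1 t)); nra. }
  apply (@constant_vanishing (fun t => t ^ 3 * W2 t) T K); [| exact HK].
  intros t Ht; destruct (Hv t Ht) as [V1 [V2 [V3 V4]]]; unfold W2.
  derive_system Hy t Ht.
  rewrite_derive V1; rewrite_derive V2; rewrite_derive V3; rewrite_derive V4.
  field; lra.
Qed.

Section OneSolution.
Variables (y1 y2 z1 z2 : R -> R).
Hypothesis sys : real_system t0 a b y1 y2 z1 z2.
Hypothesis dec : decaying y1 y2 z1 z2.

(* The imaginary part of [t ^ 3 * dy * conj y]; multiplying the equation by
   [t ^ 3 * conj y] shows that its derivative is [- Im lam * t ^ 3 * |y| ^ 2]. *)
Let G t := t ^ 3 * (z2 t * y1 t - z1 t * y2 t).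

Lemma flux_derive t :
  t0 <= t -> is_derive G t (- (b * (t ^ 3 * (y1 t ^ 2 + y2 t ^ 2)))).
Proof. intros Ht; unfold G; derive_system sys t Ht; field; lra. Qed.

Lemma flux_vanishes :
  exists T K : R, forall t, T <= t -> t * Rabs (G t) <= K.
Proof.
apply (cubic_product_vanishes (fun t => z2 t * y1 t - z1 t * y2 t) dec dec).
intros t; apply Rabs_le; split.
- pose proof (pow2_ge_0 (z2 t + y1 t)); pose proof (pow2_ge_0 (z1 t - y2 t)); nra.
- pose proof (pow2_ge_0 (z2 t - y1 t)); pose proof (pow2_ge_0 (z1 t + y2 t)); nra.
Qed.

(** For real [lam] the flux [G] is constant and vanishes at infinity. The conclusion says that
    [dy conj y] is real at [t0]. *)
Lemma decaying_real_direction :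
  b = 0 -> z2 t0 * y1 t0 - z1 t0 * y2 t0 = 0.
Proof.
intros Hb; destruct flux_vanishes as [T [K HK]].
apply (Rmult_eq_reg_l (t0 ^ 3)); [| apply pow_nonzero; lra].
rewrite Rmult_0_r; apply (@constant_vanishing G T K); [| exact HK].
intros t Ht; replace 0 with (- (b * (t ^ 3 * (y1 t ^ 2 + y2 t ^ 2))))
  by (rewrite Hb; ring).
apply flux_derive, Ht.
Qed.

(** Continuity at [t0] carries zeros found in the open half-line to the endpoint. *)
Lemma eq0_from_right (f : R -> R) (l : R) :
  is_derive f t0 l -> (forall t, t0 < t -> f t = 0) -> f t0 = 0.
Proof.
intros Hd Hf; apply NNPP; intros Hne.
assert (Hc : continuous f t0)
  by (apply (ex_derive_continuous (V := R_NormedModule)); eexists; exact Hd).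
assert (He : 0 < Rabs (f t0)) by (apply Rabs_pos_lt, Hne).
destruct (proj1 (filterlim_locally f (f t0)) Hc (mkposreal _ He)) as [d Hd'].
specialize (Hd' (t0 + d / 2)); pose proof (cond_pos d) as Hdp.
assert (Hb : ball t0 d (t0 + d / 2)).
{ change (Rabs (t0 + d / 2 - t0) < d); rewrite Rabs_pos_eq; lra. }
specialize (Hd' Hb); change (Rabs (f (t0 + d / 2) - f t0) < Rabs (f t0)) in Hd'.
rewrite Hf in Hd' by lra; rewrite Rminus_0_l, Rabs_Ropp in Hd'; lra.
Qed.

(** The flux is monotone because [b] has a fixed sign, starts at zero and tends to zero, so it is
    identically zero. Its derivative then forces [y = 0], hence [dy = 0], for [t > t0], and
    continuity reaches [t0]. *)
Lemma zero_data_of_flux_zero :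
  b <> 0 -> z2 t0 * y1 t0 - z1 t0 * y2 t0 = 0 ->
  y1 t0 = 0 /\ y2 t0 = 0 /\ z1 t0 = 0 /\ z2 t0 = 0.
Proof.
intros Hb H0; destruct flux_vanishes as [T [K HK]].
assert (HG0 : G t0 = 0) by (unfold G; rewrite H0; ring).
assert (Hsq : forall t, t0 <= t -> 0 <= t ^ 3 * (y1 t ^ 2 + y2 t ^ 2)).
{ intros t Ht; apply Rmult_le_pos; [apply pow_le; lra |].
  apply Rplus_le_le_0_compat; apply pow2_ge_0. }
assert (HG : forall t, t0 <= t -> G t = 0).
{ intros t Ht; destruct (Rle_or_lt 0 b) as [Hpos | Hneg].
  - assert (Hm : forall s t, t0 <= s -> s <= t -> G t <= G s).
    { apply (@nonincreasing_from t0 G _ flux_derive).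
      intros s Hs; specialize (Hsq s Hs); nra. }
    apply Rle_antisym; [rewrite <- HG0; apply Hm; lra |].
    apply (nonincreasing_vanishing_ge0 _ Hm HK Ht).
  - assert (Hm : forall s t, t0 <= s -> s <= t -> G s <= G t).
    { apply (@nondecreasing_from t0 G _ flux_derive).
      intros s Hs; specialize (Hsq s Hs); nra. }
    apply Rle_antisym; [| rewrite <- HG0; apply Hm; lra].
    enough (0 <= - G t) by lra.
    apply (@nonincreasing_vanishing_ge0 t0 T K (fun t => - G t)); auto.
    + intros s u Hs Hsu; specialize (Hm s u Hs Hsu); lra.
    + intros s Hs; rewrite Rabs_Ropp; auto. }
(* The ball of radius [t - t0] around [t] stays where [f] vanishes. The first alternative is used
   for [G], the second for [y1] and [y2]. *)
assert (right_derive0 : forall (f : R -> R) (t l : R), t0 < t ->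
          (forall s, t0 <= s -> f s = 0) \/ (forall s, t0 < s -> f s = 0) ->
          is_derive f t l -> l = 0).
{ intros f t l Ht Hf Hd.
  rewrite <- (is_derive_unique _ _ _ Hd).
  apply is_derive_unique, (is_derive_ext_loc (fun _ => 0)).
  - assert (Hp : 0 < t - t0) by lra.
    exists (mkposreal _ Hp); intros s Hs.
    change (Rabs (s - t) < t - t0) in Hs; apply Rabs_lt_between in Hs.
    symmetry; destruct Hf as [Hf | Hf]; apply Hf; lra.
  - apply is_derive_Reals, derivable_pt_lim_const. }
assert (Hy : forall t, t0 < t -> y1 t = 0 /\ y2 t = 0).
{ intros t Ht.
  assert (E : - (b * (t ^ 3 * (y1 t ^ 2 + y2 t ^ 2))) = 0).
  { apply (right_derive0 G t); auto; apply flux_derive; lra. }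
  assert (Ht3 : 0 < t ^ 3) by (apply pow_lt; lra).
  assert (E' : y1 t ^ 2 + y2 t ^ 2 = 0).
  { apply (Rmult_eq_reg_l (b * t ^ 3)); [lra |].
    apply Rmult_integral_contrapositive_currified; lra. }
  pose proof (pow2_ge_0 (y1 t)); pose proof (pow2_ge_0 (y2 t)).
  split; apply Rsqr_0_uniq; unfold Rsqr; lra. }
assert (Hz : forall t, t0 < t -> z1 t = 0 /\ z2 t = 0).
{ intros t Ht; destruct (sys (Rlt_le _ _ Ht)) as [D1 [D2 _]].
  split; [apply (right_derive0 y1 t) | apply (right_derive0 y2 t)]; auto;
    right; intros s Hs; apply Hy, Hs. }
destruct (sys (Rle_refl t0)) as [D1 [D2 [D3 D4]]].
repeat split.
- apply (eq0_from_right D1); intros; apply Hy; assumption.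
- apply (eq0_from_right D2); intros; apply Hy; assumption.
- apply (eq0_from_right D3); intros; apply Hz; assumption.
- apply (eq0_from_right D4); intros; apply Hz; assumption.
Qed.
End OneSolution.
End Subdominant.

(** * Reduction to two-sided derivatives *)

Section HalfLine.
Variable t0 : R.

(* Affine continuation below [t0] turns the right derivative at [t0] into a two-sided
   one. *)
Definition extend_left (f df : R -> R) (s : R) : R :=
  if Rle_dec t0 s then f s else f t0 + (s - t0) * df t0.

Lemma extend_left_right (f df : R -> R) (s : R) :
  t0 <= s -> extend_left f df s = f s.
Proof. intros Hs; unfold extend_left; destruct (Rle_dec t0 s); lra. Qed.

(** For [t > t0] the extension agrees with [f] near [t]; at [t0] the affine piece has the slope of
    the right derivative. *)
Lemma is_derive_extend_left (f df : R -> R) (t : R) :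
  t0 <= t ->
  filterdiff f (within (fun s : R => t0 <= s) (locally t))
    (fun h : R => scal h (df t)) ->
  is_derive (extend_left f df) t (df t).
Proof.
intros Ht [_ H]; split; [apply (is_linear_scal_l (df t)) |].
intros x Hx; apply (is_filter_lim_locally_unique (V := R_NormedModule)) in Hx; subst x; intros eps.
specialize (H t (fun Q HQ => filter_imp _ _ (fun s q _ => q) HQ) eps).
unfold within in H.
destruct (Req_dec t t0) as [-> | Hne].
- revert H; apply filter_imp; intros s Hs.
  rewrite (extend_left_right f df (Rle_refl t0)).
  unfold extend_left; destruct (Rle_dec t0 s) as [Hle | Hlt]; [exact (Hs Hle) |].
  unfold minus, plus, opp, scal, norm; cbn.
  unfold mult, abs; cbn.
  (* On the affine side the first-order remainder is exactly zero. *)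
  replace (f t0 + (s - t0) * df t0 + - f t0 + - ((s + - t0) * df t0)) with 0 by ring.
  rewrite Rabs_R0; apply Rmult_le_pos; [left; apply cond_pos | apply Rabs_pos].
- assert (Hp : 0 < t - t0) by lra.
  generalize (filter_and _ _ H (locally_ball t (mkposreal _ Hp))).
  apply filter_imp; intros s [Hs Hb].
  change (Rabs (s - t) < t - t0) in Hb; apply Rabs_lt_between in Hb.
  rewrite !extend_left_right by lra; apply Hs; lra.
Qed.

Lemma is_derive_from_components (f : R -> C) (t : R) (l : C) :
  is_derive_from t0 f t l ->
  filterdiff (fun s => fst (f s)) (within (fun s : R => t0 <= s) (locally t))
    (fun h : R => scal h (fst l)) /\
  filterdiff (fun s => snd (f s)) (within (fun s : R => t0 <= s) (locally t))
    (fun h : R => scal h (snd l)).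
Proof.
intros H; split.
- apply (filterdiff_comp f (fun u : C_R_NormedModule => fst u)
           (fun h : R => scal h l) (fun u => fst u) H).
  apply filterdiff_linear, is_linear_fst.
- apply (filterdiff_comp f (fun u : C_R_NormedModule => snd u)
           (fun h : R => scal h l) (fun u => snd u) H).
  apply filterdiff_linear, is_linear_snd.
Qed.

(** The components of [y] are continued with slope [dy], those of [dy] with slope [ddy], so the
    system holds with two-sided derivatives even at [t0]. *)
Lemma solves_real_system (lam : C) (y dy : R -> C) :
  solves t0 lam y dy ->
  exists y1 y2 z1 z2 : R -> R,
    real_system t0 (Re lam) (Im lam) y1 y2 z1 z2 /\
    forall t, t0 <= t -> y t = (y1 t, y2 t) /\ dy t = (z1 t, z2 t).
Proof.
intros [ddy H].
exists (extend_left (fun t => fst (y t)) (fun t => fst (dy t))),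
  (extend_left (fun t => snd (y t)) (fun t => snd (dy t))),
  (extend_left (fun t => fst (dy t)) (fun t => fst (ddy t))),
  (extend_left (fun t => snd (dy t)) (fun t => snd (ddy t))).
split.
- intros t Ht; rewrite !extend_left_right by exact Ht.
  destruct (H t Ht) as [Hy [Hdy E]].
  apply is_derive_from_components in Hy; destruct Hy as [Y1 Y2].
  apply is_derive_from_components in Hdy; destruct Hdy as [Z1 Z2].
  pose proof (f_equal fst E) as E1; pose proof (f_equal snd E) as E2.
  cbn in E1, E2.
  refine (conj _ (conj _ (conj _ _))).
  + exact (@is_derive_extend_left (fun s => fst (y s)) (fun s => fst (dy s)) t Ht Y1).
  + exact (@is_derive_extend_left (fun s => snd (y s)) (fun s => snd (dy s)) t Ht Y2).
  + replace (- (3 / t * fst (dy t)) - _) with (fst (ddy t)) by (unfold Re, Im; lra).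
    exact (@is_derive_extend_left (fun s => fst (dy s)) (fun s => fst (ddy s)) t Ht Z1).
  + replace (- (3 / t * snd (dy t)) - _) with (snd (ddy t)) by (unfold Re, Im; lra).
    exact (@is_derive_extend_left (fun s => snd (dy s)) (fun s => snd (ddy s)) t Ht Z2).
- intros t Ht; rewrite !extend_left_right by exact Ht.
  split; apply surjective_pairing.
Qed.
End HalfLine.

(** * Asymptotics *)

Lemma Cmod_sq (z : C) : Cmod z ^ 2 = fst z ^ 2 + snd z ^ 2.
Proof. unfold Cmod; apply pow2_sqrt, Rplus_le_le_0_compat; apply pow2_ge_0. Qed.

Lemma eventually_ge (T : R) : Rbar_locally p_infty (fun t => T <= t).
Proof. exists T; intros; lra. Qed.

(** The common shape of the bounds on [ln |y| / t]: a constant factor contributes to [c1], a power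
    of [t] to [c2]. *)
Lemma is_lim_affine_inv_ln (c0 c1 c2 : R) :
  is_lim (fun t => c0 + c1 * / t + c2 * (ln t / t)) p_infty c0.
Proof.
replace (Finite c0) with (Finite (c0 + c1 * 0 + c2 * 0)) by (f_equal; ring).
apply (is_lim_plus' _ _ p_infty); [apply (is_lim_plus' _ _ p_infty) |].
- apply is_lim_const.
- apply (is_lim_scal_l _ c1 p_infty 0).
  apply (is_lim_inv (fun t => t) p_infty p_infty (is_lim_id p_infty)); discriminate.
- apply (is_lim_scal_l _ c2 p_infty 0), is_lim_div_ln_p.
Qed.

Lemma exp_growth_of_bounds (f : R -> C) (kappa k1 k2 T : R) :
  0 < kappa -> 0 < k1 -> 0 < T ->
  (forall t, T <= t ->
     k1 * exp (2 * kappa * t) / t ^ 6 <= Cmod (f t) ^ 2 <= k2 * exp (2 * kappa * t)) ->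
  exp_growth f kappa.
Proof.
intros Hk Hk1 HT H.
assert (Hk2 : 0 < k2).
{ destruct (H T (Rle_refl T)) as [H1 H2].
  pose proof (exp_pos (2 * kappa * T)) as He.
  assert (0 < k1 * exp (2 * kappa * T) / T ^ 6).
  { apply Rdiv_lt_0_compat; [apply Rmult_lt_0_compat; assumption | apply pow_lt, HT]. }
  apply (Rmult_lt_reg_r (exp (2 * kappa * T))); lra. }
assert (Hpos : forall t, T <= t -> 0 < Cmod (f t)).
{ intros t Ht; destruct (H t Ht) as [H1 _].
  assert (0 < k1 * exp (2 * kappa * t) / t ^ 6).
  { apply Rdiv_lt_0_compat; [apply Rmult_lt_0_compat; [assumption | apply exp_pos] |].
    apply pow_lt; lra. }
  destruct (Cmod_ge_0 (f t)) as [| E]; [assumption |].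
  rewrite <- E in H1; rewrite pow_i in H1 by auto; lra. }
assert (Hln : is_lim (fun t => / t * ln (Cmod (f t))) p_infty kappa).
{ apply (is_lim_le_le_loc (fun t => kappa + ln k1 / 2 * / t + - 3 * (ln t / t))
           (fun t => kappa + ln k2 / 2 * / t + 0 * (ln t / t)));
    try apply is_lim_affine_inv_ln.
  generalize (eventually_ge T); apply filter_imp; intros t Ht.
  destruct (H t Ht) as [H1 H2]; specialize (Hpos t Ht).
  assert (Ht0 : 0 < t) by lra.
  assert (Ht6 : 0 < t ^ 6) by (apply pow_lt, Ht0).
  pose proof (exp_pos (2 * kappa * t)) as He.
  assert (Hsq : ln (Cmod (f t) ^ 2) = 2 * ln (Cmod (f t)))
    by (rewrite (ln_pow _ 2 Hpos); simpl; ring).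
  apply ln_le in H1; [| apply Rdiv_lt_0_compat; [apply Rmult_lt_0_compat |]; assumption].
  apply ln_le in H2; [| apply pow_lt, Hpos].
  unfold Rdiv in H1; rewrite Hsq in H1, H2.
  rewrite !ln_mult, ln_Rinv, ln_exp, (ln_pow _ 6 Ht0) in H1;
    try assumption; try (apply Rmult_lt_0_compat; assumption);
    try (apply Rinv_0_lt_compat; assumption).
  rewrite ln_mult, ln_exp in H2 by assumption.
  replace (INR 6) with 6 in H1 by (simpl; ring).
  split; apply (Rmult_le_reg_l t); try exact Ht0.
  - replace (t * (kappa + ln k1 / 2 * / t + - 3 * (ln t / t)))
      with (kappa * t + ln k1 / 2 - 3 * ln t) by (field; lra).
    replace (t * (/ t * ln (Cmod (f t)))) with (ln (Cmod (f t))) by (field; lra).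
    lra.
  - replace (t * (kappa + ln k2 / 2 * / t + 0 * (ln t / t)))
      with (kappa * t + ln k2 / 2) by (field; lra).
    replace (t * (/ t * ln (Cmod (f t)))) with (ln (Cmod (f t))) by (field; lra).
    lra. }
split; [exact Hk | split; [| exact Hln]].
(* Divergence follows from the rate: eventually [ln |y| >= kappa t / 2], and [exp x >= 1 + x]. *)
apply (is_lim_le_p_loc (fun t => kappa / 2 * t)).
- assert (Hhalf : 0 < kappa / 2) by lra.
  generalize (proj2 (is_lim_spec _ _ _) Hln (mkposreal _ Hhalf)).
  intros Hev; generalize (filter_and _ _ (eventually_ge T) Hev).
  apply filter_imp; intros t [Ht Hc]; cbn in Hc.
  specialize (Hpos t Ht); apply Rabs_lt_between in Hc.
  rewrite <- (exp_ln _ Hpos).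
  apply Rle_trans with (ln (Cmod (f t))).
  + replace (ln (Cmod (f t))) with (/ t * ln (Cmod (f t)) * t) by (field; lra).
    apply Rmult_le_compat_r; lra.
  + pose proof (exp_ineq1_le (ln (Cmod (f t)))); lra.
- pose proof (is_lim_scal_l _ (kappa / 2) _ _ (is_lim_id p_infty)) as L.
  replace (Rbar_mult (kappa / 2) p_infty) with p_infty in L; [exact L |].
  symmetry; apply is_Rbar_mult_unique, is_Rbar_mult_sym, is_Rbar_mult_p_infty_pos.
  cbn; lra.
Qed.

Lemma tends_to_of_cubic_bound (f : R -> C) (l : C) (T K : R) :
  (forall t, T <= t -> t ^ 3 * Cmod (f t - l) ^ 2 <= K) -> tends_to f l.
Proof.
intros H; apply filterlim_locally; intros eps.
pose proof (cond_pos eps) as He; set (e := pos eps) in *.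
(* For [t > 1], [t <= t ^ 3], so [t |f t - l| ^ 2 <= K < t e ^ 2]. *)
exists (Rmax T (Rmax 1 (K / e ^ 2))); intros t Ht.
assert (Hm : Rmax 1 (K / e ^ 2) < t) by (eapply Rle_lt_trans; [apply Rmax_r | exact Ht]).
assert (HT : T <= t) by (eapply Rle_trans; [apply Rmax_l | left; exact Ht]).
assert (H1 : 1 < t) by (eapply Rle_lt_trans; [apply Rmax_l | exact Hm]).
assert (HK : K / e ^ 2 < t) by (eapply Rle_lt_trans; [apply Rmax_r | exact Hm]).
specialize (H t HT); rewrite Cmod_sq in H; cbn in H.
set (u := fst (f t) + - fst l) in *; set (v := snd (f t) + - snd l) in *.
assert (He2 : 0 < e ^ 2) by (apply pow_lt, He).
assert (HK' : K < t * e ^ 2).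
{ apply (Rmult_lt_compat_r (e ^ 2)) in HK; [| exact He2].
  replace (K / e ^ 2 * e ^ 2) with K in HK by (field; lra). exact HK. }
assert (Hlt : u ^ 2 + v ^ 2 < e ^ 2).
{ apply (Rmult_lt_reg_l t); [lra |].
  apply Rle_lt_trans with K; [| exact HK'].
  apply Rle_trans with (t ^ 3 * (u ^ 2 + v ^ 2)); [| cbn; exact H].
  apply Rmult_le_compat_r; [apply Rplus_le_le_0_compat; apply pow2_ge_0 |].
  nra. }
pose proof (pow2_ge_0 u); pose proof (pow2_ge_0 v).
(* Balls of the product uniform structure on [C] are tested componentwise. *)
split; [change (Rabs u < e) | change (Rabs v < e)];
  rewrite <- (Rabs_pos_eq e) by lra; apply Rsqr_lt_abs_0; unfold Rsqr; lra.
Qed.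

Lemma is_O_of_cubic_bound (f : R -> C) (T K : R) :
  (forall t, T <= t -> t ^ 3 * Cmod (f t) ^ 2 <= K) ->
  is_O_infty f (fun t => Rpower t (- (3 / 2))).
Proof.
intros H; exists (sqrt K).
generalize (filter_and _ _ (eventually_ge T) (eventually_ge 1)).
apply filter_imp; intros t [HT H1]; specialize (H t HT).
assert (Ht3 : 0 < t ^ 3) by (apply pow_lt; lra).
set (r := Rpower t (- (3 / 2))).
assert (Hr : 0 < r) by apply exp_pos.
assert (Er : t ^ 3 * (r * r) = 1).
{ unfold r; rewrite <- Rpower_plus, <- (Rpower_pow 3 t), <- Rpower_plus by lra.
  replace (INR 3 + (- (3 / 2) + - (3 / 2))) with 0 by (simpl; field).
  apply Rpower_O; lra. }
rewrite (Rabs_pos_eq r) by lra.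
assert (HK : 0 <= K).
{ eapply Rle_trans; [| exact H]; apply Rmult_le_pos; [lra | apply pow2_ge_0]. }
apply Rsqr_incr_0_var; [| apply Rmult_le_pos; [apply sqrt_pos | lra]].
rewrite Rsqr_mult, Rsqr_sqrt by exact HK.
apply (Rmult_le_reg_l (t ^ 3)); [exact Ht3 |].
unfold Rsqr; replace (t ^ 3 * (K * (r * r))) with (K * (t ^ 3 * (r * r))) by ring.
rewrite Er; lra.
Qed.

(** * Bounds for positive [lam] and explicit formulas for zero [lam] *)

Lemma oscillatory_bounds (t0 l : R) (y1 y2 z1 z2 : R -> R) :
  0 < t0 -> 0 < l -> real_system t0 l 0 y1 y2 z1 z2 ->
  exists T K : R, forall t, T <= t ->
    t ^ 3 * (y1 t ^ 2 + y2 t ^ 2) <= K /\ t ^ 3 * (z1 t ^ 2 + z2 t ^ 2) <= K.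
Proof.
intros Ht0 Hl sys.
set (s := sqrt l).
assert (Hs : 0 < s) by (apply sqrt_lt_R0, Hl).
assert (Hss : l = s ^ 2) by (unfold s; rewrite pow2_sqrt; lra).
set (v1 t := z1 t + 3 / (2 * t) * y1 t).
set (v2 t := z2 t + 3 / (2 * t) * y2 t).
(* With [u = t ^ (3/2) * y] the equation reads [u'' + (l - 3 / (4 t^2)) u = 0], and
   [u' = t ^ (3/2) * v], so [E] is the energy [|u'|^2 + l |u|^2]. *)
set (E t := t ^ 3 * (v1 t ^ 2 + v2 t ^ 2 + l * (y1 t ^ 2 + y2 t ^ 2))).
(* An integrating factor: [E' = (3/2) t Re (y conj v)] is at most [3 / (4 s t ^ 2) E], which the
   derivative of [g] cancels. Since [g > 1], the bound on [E g] also bounds [E]. *)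
set (g t := exp (3 / (4 * s) * / t)).
assert (Hdec : forall t, t0 <= t -> E t * g t <= E t0 * g t0).
{ intros t Ht.
  apply (@nonincreasing_from t0 (fun t => E t * g t)
    (fun t => (3 / 2 * t * (y1 t * v1 t + y2 t * v2 t)
               - 3 / (4 * s) * / t ^ 2 * E t) * g t)); try lra.
  - intros x Hx; unfold E, g, v1, v2.
    derive_system sys x Hx.
    field; repeat split; lra.
  - intros x Hx.
    (* Completing the square, with [l = s ^ 2], leaves a negative multiple of [|v - s y| ^ 2]. *)
    replace ((3 / 2 * x * (y1 x * v1 x + y2 x * v2 x)
               - 3 / (4 * s) * / x ^ 2 * E x) * g x)
      with (- (3 / (4 * s) * x * g x *
               ((v1 x - s * y1 x) ^ 2 + (v2 x - s * y2 x) ^ 2)))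
      by (unfold E; rewrite Hss; field; split; lra).
    apply Rge_le, Ropp_0_le_ge_contravar.
    assert (0 < 3 / (4 * s)) by (apply Rdiv_lt_0_compat; lra).
    apply Rmult_le_pos.
    + apply Rmult_le_pos; [apply Rmult_le_pos; lra | left; apply exp_pos].
    + apply Rplus_le_le_0_compat; apply pow2_ge_0. }
set (K := E t0 * g t0) in *.
(* For [t >= 1], [dy = v - q y] with [q = 3 / (2 t) <= 3 / 2], so
   [|dy| ^ 2 <= 2 |v| ^ 2 + (9/2) |y| ^ 2]. The sum serves both bounds. *)
exists (Rmax t0 1), (K / l + (2 * K + 9 / 2 * (K / l))); intros t Ht.
assert (H0 : t0 <= t) by (eapply Rle_trans; [apply Rmax_l | exact Ht]).
assert (H1 : 1 <= t) by (eapply Rle_trans; [apply Rmax_r | exact Ht]).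
specialize (Hdec t H0).
assert (Ht3 : 0 < t ^ 3) by (apply pow_lt; lra).
assert (HV : 0 <= v1 t ^ 2 + v2 t ^ 2) by (apply Rplus_le_le_0_compat; apply pow2_ge_0).
assert (HY : 0 <= y1 t ^ 2 + y2 t ^ 2) by (apply Rplus_le_le_0_compat; apply pow2_ge_0).
assert (HV' : 0 <= t ^ 3 * (v1 t ^ 2 + v2 t ^ 2)) by (apply Rmult_le_pos; lra).
assert (HY' : 0 <= t ^ 3 * (y1 t ^ 2 + y2 t ^ 2)) by (apply Rmult_le_pos; lra).
assert (HlY : 0 <= l * (t ^ 3 * (y1 t ^ 2 + y2 t ^ 2))) by (apply Rmult_le_pos; lra).
assert (EE : E t = t ^ 3 * (v1 t ^ 2 + v2 t ^ 2) + l * (t ^ 3 * (y1 t ^ 2 + y2 t ^ 2)))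
  by (unfold E; ring).
assert (HE : E t <= K).
{ apply Rle_trans with (E t * g t); [| exact Hdec].
  rewrite <- (Rmult_1_r (E t)) at 1; apply Rmult_le_compat_l; [lra |].
  unfold g; rewrite <- exp_0; left; apply exp_increasing.
  apply Rmult_lt_0_compat; [apply Rdiv_lt_0_compat | apply Rinv_0_lt_compat]; lra. }
assert (HyK : t ^ 3 * (y1 t ^ 2 + y2 t ^ 2) <= K / l).
{ apply (Rmult_le_reg_l l); [exact Hl |].
  replace (l * (K / l)) with K by (field; lra). lra. }
split; [lra |].
set (q := 3 / (2 * t)) in *.
assert (Hq : 0 <= q <= 3 / 2).
{ unfold q; split; [apply Rlt_le, Rdiv_lt_0_compat; lra |].
  apply (Rmult_le_reg_r (2 * t)); [lra |].
  replace (3 / (2 * t) * (2 * t)) with 3 by (field; lra). lra. }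
assert (Hz : z1 t ^ 2 + z2 t ^ 2
             <= 2 * (v1 t ^ 2 + v2 t ^ 2) + 9 / 2 * (y1 t ^ 2 + y2 t ^ 2)).
{ apply Rle_trans with (2 * (v1 t ^ 2 + v2 t ^ 2) + 2 * q ^ 2 * (y1 t ^ 2 + y2 t ^ 2)).
  - unfold v1, v2; fold q.
    pose proof (pow2_ge_0 (z1 t + 2 * q * y1 t));
    pose proof (pow2_ge_0 (z2 t + 2 * q * y2 t)); nra.
  - apply Rplus_le_compat_l, Rmult_le_compat_r; nra. }
apply (Rmult_le_compat_l (t ^ 3)) in Hz; [| lra]; lra.
Qed.

Lemma undamped_solution (t0 : R) (y1 y2 z1 z2 : R -> R) :
  0 < t0 -> real_system t0 0 0 y1 y2 z1 z2 ->
  forall t, t0 <= t ->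
    y1 t = y1 t0 + t0 / 2 * z1 t0 * (1 - t0 ^ 2 / t ^ 2) /\
    y2 t = y2 t0 + t0 / 2 * z2 t0 * (1 - t0 ^ 2 / t ^ 2) /\
    z1 t = (t0 / t) ^ 3 * z1 t0 /\ z2 t = (t0 / t) ^ 3 * z2 t0.
Proof.
intros Ht0 sys t Ht.
assert (Hz1 : t ^ 3 * z1 t = t0 ^ 3 * z1 t0).
{ apply (@constant_from t0 (fun t => t ^ 3 * z1 t)); [| exact Ht].
  intros x Hx; derive_system sys x Hx; field; lra. }
assert (Hz2 : t ^ 3 * z2 t = t0 ^ 3 * z2 t0).
{ apply (@constant_from t0 (fun t => t ^ 3 * z2 t)); [| exact Ht].
  intros x Hx; derive_system sys x Hx; field; lra. }
assert (Hy1 : y1 t + t * z1 t / 2 = y1 t0 + t0 * z1 t0 / 2).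
{ apply (@constant_from t0 (fun t => y1 t + t * z1 t / 2)); [| exact Ht].
  intros x Hx; derive_system sys x Hx; field; lra. }
assert (Hy2 : y2 t + t * z2 t / 2 = y2 t0 + t0 * z2 t0 / 2).
{ apply (@constant_from t0 (fun t => y2 t + t * z2 t / 2)); [| exact Ht].
  intros x Hx; derive_system sys x Hx; field; lra. }
assert (Ez1 : z1 t = (t0 / t) ^ 3 * z1 t0).
{ transitivity (t ^ 3 * z1 t / t ^ 3); [field; lra | rewrite Hz1; field; lra]. }
assert (Ez2 : z2 t = (t0 / t) ^ 3 * z2 t0).
{ transitivity (t ^ 3 * z2 t / t ^ 3); [field; lra | rewrite Hz2; field; lra]. }
rewrite Ez1 in Hy1; rewrite Ez2 in Hy2.
repeat split; try assumption.
- transitivity (y1 t0 + t0 * z1 t0 / 2 - t * ((t0 / t) ^ 3 * z1 t0) / 2); [lra | field; lra].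
- transitivity (y2 t0 + t0 * z2 t0 / 2 - t * ((t0 / t) ^ 3 * z2 t0) / 2); [lra | field; lra].
Qed.

(** * The exceptional line *)

Definition decaying_data (t0 : R) (lam c d : C) : Prop :=
  exists y1 y2 z1 z2 : R -> R,
    real_system t0 (Re lam) (Im lam) y1 y2 z1 z2 /\ decaying y1 y2 z1 z2 /\
    c = (y1 t0, y2 t0) /\ d = (z1 t0, z2 t0).

Section DecayingData.
Variables (t0 : R) (lam : C).
Hypothesis t0_gt0 : 0 < t0.

Lemma decaying_data_proportional (c d c' d' : C) :
  decaying_data t0 lam c d -> decaying_data t0 lam c' d' -> (c * d' = d * c')%C.
Proof.
intros [y1 [y2 [z1 [z2 [Sy [Dy [-> ->]]]]]]] [v1 [v2 [w1 [w2 [Sv [Dv [-> ->]]]]]]].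
destruct (decaying_wronskian t0_gt0 Sy Sv Dy Dv) as [E1 E2].
unfold Cmult; cbn; f_equal; lra.
Qed.

Lemma decaying_data_real_ratio (c d : C) :
  Im lam = 0 -> decaying_data t0 lam c d -> snd d * fst c - fst d * snd c = 0.
Proof.
intros Hl [y1 [y2 [z1 [z2 [Sy [Dy [-> ->]]]]]]].
exact (decaying_real_direction t0_gt0 Sy Dy Hl).
Qed.

Lemma decaying_data_nonreal_ratio (c d : C) :
  Im lam <> 0 -> decaying_data t0 lam c d -> snd d * fst c - fst d * snd c = 0 ->
  c = RtoC 0 /\ d = RtoC 0.
Proof.
intros Hl [y1 [y2 [z1 [z2 [Sy [Dy [-> ->]]]]]]] H.
destruct (zero_data_of_flux_zero t0_gt0 Sy Dy Hl H) as [-> [-> [-> ->]]].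
split; reflexivity.
Qed.

Lemma growth_of_not_decaying_data (kappa nu : R) (y dy : R -> C) :
  0 < kappa -> kappa ^ 2 - nu ^ 2 = - Re lam -> 2 * kappa * nu = - Im lam ->
  solves t0 lam y dy -> ~ decaying_data t0 lam (y t0) (dy t0) ->
  exp_growth y kappa.
Proof.
intros Hk Hre Him Hs Hn.
destruct (solves_real_system Hs) as [y1 [y2 [z1 [z2 [sys Heq]]]]].
destruct (dichotomy t0_gt0 Hk Hre Him sys) as [Hd | [k1 [k2 [T [Hk1 [HT H]]]]]].
- exfalso; apply Hn; exists y1, y2, z1, z2.
  destruct (Heq t0 (Rle_refl t0)); auto.
- apply (@exp_growth_of_bounds y kappa k1 k2 (Rmax T t0) Hk Hk1).
  + eapply Rlt_le_trans; [exact HT | apply Rmax_l].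
  + intros t Ht; destruct (Heq t (Rle_trans _ _ _ (Rmax_r _ _) Ht)) as [-> _].
    rewrite Cmod_sq; apply H, (Rle_trans _ _ _ (Rmax_l _ _) Ht).
Qed.

(** Multiplying decaying data [(c, d)] by [conj c] gives a real vector on the same complex line,
    because [d conj c] is real. *)
Lemma decaying_data_real_line :
  Im lam = 0 ->
  exists r1 r2 : R, (r1 <> 0 \/ r2 <> 0) /\
    forall c d : C, decaying_data t0 lam c d -> (c * RtoC r2 = d * RtoC r1)%C.
Proof.
intros Hl.
destruct (classic (exists c d, decaying_data t0 lam c d /\ c <> RtoC 0))
  as [[c [d [Hcd Hc]]] | Hno].
- pose proof (decaying_data_real_ratio Hl Hcd) as Hr.
  exists (fst c ^ 2 + snd c ^ 2), (fst d * fst c + snd d * snd c); split.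
  + left; intros E; apply Hc.
    pose proof (pow2_ge_0 (fst c)); pose proof (pow2_ge_0 (snd c)).
    apply injective_projections; apply Rsqr_0_uniq; unfold Rsqr; lra.
  + intros c' d' H.
    transitivity (c' * d * Cconj c)%C.
    * rewrite <- Cmult_assoc; f_equal.
      apply injective_projections; cbn; lra.
    * rewrite (decaying_data_proportional H Hcd), <- Cmult_assoc; f_equal.
      apply injective_projections; cbn; ring.
(* All decaying data have [c = 0] here, so they lie on the line through [(0, 1)]. *)
- exists 0, 1; split; [right; lra |].
  intros c d H; destruct (Ceq_dec c (RtoC 0)) as [-> | Hc]; [ring |].
  exfalso; apply Hno; exists c, d; auto.
Qed.

(** The nonvanishing quantity is the imaginary part of [e2 conj e1]; it excludes nonzero real points
    from the line. *)
Lemma decaying_data_nonreal_line :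
  Im lam <> 0 ->
  exists e1 e2 : C, snd e2 * fst e1 - fst e2 * snd e1 <> 0 /\
    forall c d : C, decaying_data t0 lam c d -> (c * e2 = d * e1)%C.
Proof.
intros Hl.
destruct (classic (exists c d, decaying_data t0 lam c d /\ (c <> RtoC 0 \/ d <> RtoC 0)))
  as [[c [d [Hcd Hne]]] | Hno].
- exists c, d; split.
  + intros E; destruct (decaying_data_nonreal_ratio Hl Hcd E); tauto.
  + intros c' d' H; apply (decaying_data_proportional H Hcd).
(* With only zero decaying data, any line without nonzero real points will do, such as the one
   through [(1, i)]. *)
- exists (RtoC 1), Ci; split; [cbn; lra |].
  intros c d H.
  destruct (Ceq_dec c (RtoC 0)) as [-> | Hc]; [| exfalso; apply Hno; exists c, d; auto].
  destruct (Ceq_dec d (RtoC 0)) as [-> | Hd]; [ring | exfalso; apply Hno; exists (RtoC 0), d; auto].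
Qed.
End DecayingData.

(** * Lines through the origin as one-dimensional and null subspaces *)

Lemma C_proportional (e1 e2 u1 u2 : C) :
  (e1 <> RtoC 0 \/ e2 <> RtoC 0) -> (u1 * e2 = u2 * e1)%C ->
  exists k : C, u1 = (k * e1)%C /\ u2 = (k * e2)%C.
Proof.
intros He H; destruct (Ceq_dec e1 (RtoC 0)) as [-> | Hne].
- destruct He as [He | He]; [congruence |].
  exists (u2 / e2)%C; split; [| field; exact He].
  transitivity (u1 * e2 / e2)%C; [field; exact He |].
  rewrite H; field; exact He.
- exists (u1 / e1)%C; split; [field; exact Hne |].
  transitivity (u2 * e1 / e1)%C; [field; exact Hne |].
  rewrite <- H; field; exact Hne.
Qed.

Lemma C2_line_one_dim (e1 e2 : C) :
  (e1 <> RtoC 0 \/ e2 <> RtoC 0) ->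
  is_one_dim_subspace C2 (fun v : C * C => fst v * e2 = snd v * e1)%C.
Proof.
intros He; split.
- split; [change (RtoC 0 * e2 = RtoC 0 * e1)%C; ring |].
  split.
  + intros [u1 u2] [v1 v2]; cbn; intros H H'.
    change ((u1 + v1) * e2 = (u2 + v2) * e1)%C.
    transitivity (u1 * e2 + v1 * e2)%C; [ring | rewrite H, H'; ring].
  + intros k [u1 u2]; cbn; intros H.
    change (k * u1 * e2 = k * u2 * e1)%C.
    rewrite <- !Cmult_assoc, H; reflexivity.
- exists (e1, e2); split; [apply Cmult_comm |]; split.
  + intros E; apply (f_equal fst) in E as E1; apply (f_equal snd) in E as E2.
    destruct He as [He | He]; apply He; assumption.
  + intros u H; destruct (C_proportional He H) as [k [E1 E2]].
    exists k; apply injective_projections; assumption.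
Qed.

Lemma R_proportional (e1 e2 u1 u2 : R) :
  (e1 <> 0 \/ e2 <> 0) -> u1 * e2 = u2 * e1 ->
  exists k : R, u1 = k * e1 /\ u2 = k * e2.
Proof.
intros He H; destruct (Req_dec e1 0) as [-> | Hne].
- destruct He as [He | He]; [congruence |].
  exists (u2 / e2); split; [| field; exact He].
  apply (Rmult_eq_reg_r e2); [rewrite H; ring | exact He].
- exists (u1 / e1); split; [field; exact Hne |].
  apply (Rmult_eq_reg_r e1); [rewrite <- H; field |]; exact Hne.
Qed.

Lemma R2_line_one_dim (S : R2 -> Prop) (r1 r2 : R) :
  (r1 <> 0 \/ r2 <> 0) ->
  (forall p : R * R, S p <-> fst p * r2 = snd p * r1) ->
  is_one_dim_subspace R2 S.
Proof.
intros Hr HS; split.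
- split; [apply HS; change (0 * r2 = 0 * r1); ring |].
  split.
  + intros [u1 u2] [v1 v2] H H'; apply HS in H; apply HS in H'; apply HS; cbn in *.
    change ((u1 + v1) * r2 = (u2 + v2) * r1); lra.
  + intros k [u1 u2] H; apply HS in H; apply HS; cbn in *.
    change (k * u1 * r2 = k * u2 * r1); rewrite !Rmult_assoc, H; reflexivity.
- exists (r1, r2); split; [apply HS, Rmult_comm |]; split.
  + intros E; apply (f_equal fst) in E as E1; apply (f_equal snd) in E as E2.
    destruct Hr as [Hr | Hr]; apply Hr; assumption.
  + intros u H; apply HS in H; destruct (R_proportional Hr H) as [k [E1 E2]].
    exists k; apply injective_projections; assumption.
Qed.

Lemma null2_line (A : R * R -> Prop) (r1 r2 : R) :
  (r1 <> 0 \/ r2 <> 0) -> (forall p, A p -> fst p * r2 = snd p * r1) ->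
  lebesgue_null2 A.
Proof.
intros Hr HA; destruct (Req_dec r1 0) as [E | Hne].
- apply (@NullLine.null2_subset _ _ NullLine.null2_axis); intros p Hp.
  destruct Hr as [Hr | Hr]; [contradiction |].
  apply (Rmult_eq_reg_r r2); [rewrite (HA p Hp), E; ring | exact Hr].
- apply (@NullLine.null2_subset _ _ (NullLine.null2_graph (r2 / r1))); intros p Hp.
  apply (Rmult_eq_reg_r r1); [rewrite <- (HA p Hp); field |]; exact Hne.
Qed.

(** Multiplying [Csqrt z] by [-i] or [i], according to the sign of its imaginary part, gives the
    root of [- z] with positive real part; [nu] is the imaginary part of that root. *)
Lemma Csqrt_exponents (z : C) :
  Im z <> 0 ->
  exists nu, 0 < Rabs (Im (Csqrt z)) /\
    Rabs (Im (Csqrt z)) ^ 2 - nu ^ 2 = - Re z /\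
    2 * Rabs (Im (Csqrt z)) * nu = - Im z.
Proof.
intros Hz; generalize (Csqrt z) (Csqrt_sqr z); intros w E.
apply (f_equal fst) in E as E1; apply (f_equal snd) in E as E2; cbn in E1, E2.
unfold Re, Im in *.
assert (Hw : snd w <> 0) by (intros H0; rewrite H0 in E2; lra).
destruct (Rle_or_lt 0 (snd w)) as [H | H].
- exists (- fst w); rewrite Rabs_pos_eq by exact H; repeat split; nra.
- exists (fst w); rewrite Rabs_left by exact H; repeat split; nra.
Qed.

Theorem lemma3 (t0 : R) (ht0 : 0 < t0) (lam : C) :
  (* (i) *)
  (forall l : R, 0 < l -> lam = RtoC l ->
     forall y dy : R -> C, solves t0 lam y dy ->
       (is_O_infty y (fun t => Rpower t (- (3 / 2))) /\ tends_to y (RtoC 0)) /\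
       (is_O_infty dy (fun t => Rpower t (- (3 / 2))) /\ tends_to dy (RtoC 0)))
  /\
  (* (ii) *)
  (forall mu : R, 0 < mu -> lam = RtoC (- mu ^ 2) ->
     exists S : C2 -> Prop,
       is_one_dim_subspace C2 S /\
       (forall y dy : R -> C, solves t0 lam y dy ->
          ~ S (y t0, dy t0) -> exp_growth y mu) /\
       is_one_dim_subspace R2 (real_points S) /\
       lebesgue_null2 (real_points S))
  /\
  (* (iii) *)
  (Im lam <> 0 ->
     exists S : C2 -> Prop,
       is_one_dim_subspace C2 S /\
       (forall y dy : R -> C, solves t0 lam y dy ->
          ~ S (y t0, dy t0) -> exp_growth y (Rabs (Im (Csqrt lam)))) /\
       (forall a b : R, real_points S (a, b) <-> (a, b) = (0, 0)) /\
       (forall (y dy : R -> C) (a b : R), solves t0 lam y dy ->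
          y t0 = RtoC a -> dy t0 = RtoC b -> (a, b) <> (0, 0) ->
          exp_growth y (Rabs (Im (Csqrt lam)))))
  /\
  (* (iv) *)
  (lam = RtoC 0 ->
     forall y dy : R -> C, solves t0 lam y dy ->
       (forall t : R, t0 <= t ->
          y t = (y t0 + RtoC (t0 / 2) * dy t0 * RtoC (1 - t0 ^ 2 / t ^ 2))%C /\
          dy t = (RtoC ((t0 / t) ^ 3) * dy t0)%C) /\
       (exists l : C, tends_to y l) /\
       tends_to dy (RtoC 0)).

Proof.
refine (conj _ (conj _ (conj _ _))).
- intros l Hl -> y dy Hs.
  destruct (solves_real_system Hs) as [y1 [y2 [z1 [z2 [sys Heq]]]]].
  destruct (oscillatory_bounds ht0 Hl sys) as [T [K H]].
  assert (By : forall t, Rmax T t0 <= t -> t ^ 3 * Cmod (y t) ^ 2 <= K).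
  { intros t Ht; destruct (Heq t (Rle_trans _ _ _ (Rmax_r _ _) Ht)) as [-> _].
    rewrite Cmod_sq; apply H, (Rle_trans _ _ _ (Rmax_l _ _) Ht). }
  assert (Bdy : forall t, Rmax T t0 <= t -> t ^ 3 * Cmod (dy t) ^ 2 <= K).
  { intros t Ht; destruct (Heq t (Rle_trans _ _ _ (Rmax_r _ _) Ht)) as [_ ->].
    rewrite Cmod_sq; apply H, (Rle_trans _ _ _ (Rmax_l _ _) Ht). }
  split; (split; [eapply is_O_of_cubic_bound | eapply tends_to_of_cubic_bound]).
  + exact By.
  + intros t Ht; replace (y t - RtoC 0)%C with (y t) by ring; exact (By t Ht).
  + exact Bdy.
  + intros t Ht; replace (dy t - RtoC 0)%C with (dy t) by ring; exact (Bdy t Ht).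
- intros mu Hmu Hlam.
  assert (Him : Im lam = 0) by (rewrite Hlam; reflexivity).
  assert (Hre : Re lam = - mu ^ 2) by (rewrite Hlam; reflexivity).
  destruct (@decaying_data_real_line t0 lam ht0 Him) as [r1 [r2 [Hr Hline]]].
  assert (HrC : RtoC r1 <> RtoC 0 \/ RtoC r2 <> RtoC 0).
  { destruct Hr as [Hr | Hr]; [left | right]; intros E; apply Hr;
      apply (f_equal fst) in E; exact E. }
  (* The coefficients are real, so on real points this complex equation is a single real one. *)
  set (S := fun v : C * C => (fst v * RtoC r2 = snd v * RtoC r1)%C).
  assert (HS : forall p : R * R, real_points S p <-> fst p * r2 = snd p * r1).
  { intros [p1 p2]; unfold real_points, S; cbn; split; intros E.
    - apply (f_equal fst) in E; cbn in E; lra.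
    - rewrite <- !RtoC_mult, E; reflexivity. }
  exists S; split; [exact (C2_line_one_dim HrC) | split; [| split]].
  + intros y dy Hs Hout.
    (* The root of [- lam = mu ^ 2] is real: [kappa = mu], [nu = 0]. *)
    apply (@growth_of_not_decaying_data t0 lam ht0 mu 0 y dy); try assumption; try lra.
    intros Hdec; apply Hout; exact (Hline _ _ Hdec).
  + exact (R2_line_one_dim _ Hr HS).
  + exact (@null2_line _ _ _ Hr (fun p => proj1 (HS p))).
- intros Hlam.
  destruct (@decaying_data_nonreal_line t0 lam ht0 Hlam) as [e1 [e2 [Hdet Hline]]].
  destruct (@Csqrt_exponents lam Hlam) as [nu [Hk [Hre Him]]].
  assert (He : e1 <> RtoC 0 \/ e2 <> RtoC 0).
  { destruct (Ceq_dec e1 (RtoC 0)) as [E | E]; [right | left; exact E].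
    intros E'; apply Hdet; rewrite E, E'; cbn; ring. }
  set (S := fun v : C * C => (fst v * e2 = snd v * e1)%C).
  assert (Hgrow : forall y dy : R -> C, solves t0 lam y dy ->
            ~ S (y t0, dy t0) -> exp_growth y (Rabs (Im (Csqrt lam)))).
  { intros y dy Hs Hout.
    apply (growth_of_not_decaying_data ht0 Hk Hre Him Hs).
    intros Hdec; apply Hout; exact (Hline _ _ Hdec). }
  assert (Hreal : forall a b : R, real_points S (a, b) <-> (a, b) = (0, 0)).
  { intros a b; unfold real_points, S; cbn; split; intros E.
    - apply (f_equal fst) in E as E1; apply (f_equal snd) in E as E2; cbn in E1, E2.
      (* Real and imaginary parts form a homogeneous real system in [a], [b], with determinant
         nonzero by [Hdet]. *)
      assert (F1 : a * fst e2 = b * fst e1) by lra.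
      assert (F2 : a * snd e2 = b * snd e1) by lra.
      f_equal; apply (Rmult_eq_reg_r (snd e2 * fst e1 - fst e2 * snd e1));
        try exact Hdet.
      + transitivity (fst e1 * (a * snd e2) - snd e1 * (a * fst e2)); [ring |].
        rewrite F1, F2; ring.
      + transitivity (snd e2 * (b * fst e1) - fst e2 * (b * snd e1)); [ring |].
        rewrite <- F1, <- F2; ring.
    - injection E as -> ->; ring. }
  exists S; split; [exact (C2_line_one_dim He) | split; [exact Hgrow | split; [exact Hreal |]]].
  intros y dy a b Hs Ea Eb Hne; apply (Hgrow y dy Hs); rewrite Ea, Eb.
  intros HS; apply Hne, Hreal, HS.
- intros -> y dy Hs.
  destruct (solves_real_system Hs) as [y1 [y2 [z1 [z2 [sys Heq]]]]].
  pose proof (undamped_solution ht0 sys) as Hsol.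
  destruct (Heq t0 (Rle_refl t0)) as [Ey0 Ez0].
  assert (Hform : forall t : R, t0 <= t ->
          y t = (y t0 + RtoC (t0 / 2) * dy t0 * RtoC (1 - t0 ^ 2 / t ^ 2))%C /\
          dy t = (RtoC ((t0 / t) ^ 3) * dy t0)%C).
  { intros t Ht; destruct (Heq t Ht) as [-> ->]; rewrite Ey0, Ez0.
    destruct (Hsol t Ht) as [-> [-> [-> ->]]].
    split; apply injective_projections; cbn; field; lra. }
  set (N := Cmod (dy t0) ^ 2).
  assert (HN : 0 <= N) by apply pow2_ge_0.
  split; [exact Hform | split].
  + exists (y t0 + RtoC (t0 / 2) * dy t0)%C.
    (* The distance to the limit is [t0 ^ 3 / (2 t ^ 2) |dy t0|]; its square times [t ^ 3] is
       [t0 ^ 6 / 4 * N / t]. *)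
    apply (@tends_to_of_cubic_bound _ _ (Rmax t0 1) (t0 ^ 6 / 4 * N)); intros t Ht.
    assert (H0 : t0 <= t) by (eapply Rle_trans; [apply Rmax_l | exact Ht]).
    assert (H1 : 1 <= t) by (eapply Rle_trans; [apply Rmax_r | exact Ht]).
    destruct (Hform t H0) as [-> _].
    replace (_ - _)%C with (RtoC (- (t0 ^ 3 / 2 / t ^ 2)) * dy t0)%C
      by (apply injective_projections; cbn; field; lra).
    rewrite Cmod_mult, Rpow_mult_distr, Cmod_R, pow2_abs; fold N.
    replace (t ^ 3 * ((- (t0 ^ 3 / 2 / t ^ 2)) ^ 2 * N)) with (/ t * (t0 ^ 6 / 4 * N))
      by (field; lra).
    assert (Hi : / t <= 1) by (rewrite <- Rinv_1; apply Rinv_le_contravar; lra).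
    rewrite <- (Rmult_1_l (t0 ^ 6 / 4 * N)) at 2.
    apply Rmult_le_compat_r; [| exact Hi].
    apply Rmult_le_pos; [| exact HN]; left; apply Rdiv_lt_0_compat; [apply pow_lt |]; lra.
  + apply (@tends_to_of_cubic_bound _ _ (Rmax t0 1) (t0 ^ 6 * N)); intros t Ht.
    assert (H0 : t0 <= t) by (eapply Rle_trans; [apply Rmax_l | exact Ht]).
    assert (H1 : 1 <= t) by (eapply Rle_trans; [apply Rmax_r | exact Ht]).
    destruct (Hform t H0) as [_ ->].
    replace (RtoC ((t0 / t) ^ 3) * dy t0 - RtoC 0)%C with (RtoC ((t0 / t) ^ 3) * dy t0)%C
      by ring.
    rewrite Cmod_mult, Rpow_mult_distr, Cmod_R, pow2_abs; fold N.
    replace (t ^ 3 * (((t0 / t) ^ 3) ^ 2 * N)) with (/ t ^ 3 * (t0 ^ 6 * N))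
      by (field; lra).
    assert (Hi : / t ^ 3 <= 1).
    { rewrite <- Rinv_1; apply Rinv_le_contravar; [lra | apply pow_R1_Rle; lra]. }
    rewrite <- (Rmult_1_l (t0 ^ 6 * N)) at 2.
    apply Rmult_le_compat_r; [| exact Hi].
    apply Rmult_le_pos; [| exact HN]; apply pow_le; lra.
Qed.
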